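(* Let $k\in\mathbb{N}$ and put $n=6^k$ and $d=3^k$. Then there exists a function $f\colon\{-1,1\}^n\to\{-1,1\}$ such that $f\in\mathrm{Deg}_{\le d}$ and $$\|\Delta f\|_{L^\infty(\{-1,1\}^n)}\ge d^{\log 6/\log 3}\,\|f\|_{L^\infty(\{-1,1\}^n)}.$$
   Context: Write $[n]=\{1,\dots,n\}$. For $f\colon\{-1,1\}^n\to\mathbb{C}$, $\|f\|_{L^\infty(\{-1,1\}^n)}=\max_{\delta\in\{-1,1\}^n}|f(\delta)|$. For $S\subseteq[n]$ the Walsh function is $w_S(\delta)=\prod_{j\in S}\delta_j$, and each $f\colon\{-1,1\}^n\to\mathbb{C}$ has the Fourier--Walsh expansion $f=\sum_{S\subseteq[n]}\widehat f(S)w_S$ with $\widehat f(S)=2^{-n}\sum_{\delta}f(\delta)w_S(\delta)$. $\mathrm{Deg}_{\le d}$ is the space of functions $f\colon\{-1,1\}^n\to\mathbb{C}$ with $\widehat f(S)=0$ whenever $|S|>d$. The Hamming cube Laplacian is $\Delta f=\sum_{j=1}^n\partial_j f$, where $\partial_j f(\delta)=\frac{f(\delta_1,\dots,\delta_j,\dots,\delta_n)-f(\delta_1,\dots,-\delta_j,\dots,\delta_n)}{2}$; equivalently $\Delta f=\sum_{S\subseteq[n]}|S|\,\widehat f(S)\,w_S$. *)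

(* Defs.v *)
From mathcomp Require Import all_boot all_order all_algebra.
From mathcomp Require Import complex.
From mathcomp Require Import reals exp.

Set Implicit Arguments.
Unset Strict Implicit.
Unset Printing Implicit Defensive.

Import Order.TTheory GRing.Theory Num.Theory.
Local Open Scope ring_scope.
Local Open Scope complex_scope.

(* A point of {-1,1}^n is stored as its vector of sign bits: the j-th
   coordinate is (-1) ^+ delta j, so that false encodes 1 and true encodes -1.
   Coordinates are indexed by 'I_n = {0, ..., n-1} instead of {1, ..., n}. *)
Definition cube (n : nat) := {ffun 'I_n -> bool}.

Section HammingCube.
Variables (R : realType) (n : nat).
Implicit Types (delta : cube n) (j : 'I_n) (S : {set 'I_n}).
Implicit Types f : cube n -> R[i].

Definition coord delta j : R[i] := (-1) ^+ delta j.

Definition flip j delta : cube n :=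
  [ffun i => if i == j then ~~ delta i else delta i].

Definition walsh S delta : R[i] := \prod_(j in S) coord delta j.

Definition fourier f S : R[i] :=
  (2 ^+ n)^-1 * \sum_(delta : cube n) f delta * walsh S delta.

Definition Deg_le (d : nat) f : Prop :=
  forall S : {set 'I_n}, (d < #|S|)%N -> fourier f S = 0.

Definition partial j f : cube n -> R[i] :=
  fun delta => (f delta - f (flip j delta)) / 2.

Definition laplacian f : cube n -> R[i] :=
  fun delta => \sum_(j < n) partial j f delta.

(* The initial value 0 does not affect this maximum: the cube is nonempty and
   the moduli are nonnegative. *)
Definition Linfty_norm f : R :=
  \big[Num.max/0]_(delta : cube n) Normc.normc (f delta).

End HammingCube.

(* Main.v *)
Require Import Defs.
From mathcomp Require Import all_boot all_order all_algebra.
From mathcomp Require Import complex.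
From mathcomp Require Import reals exp.

Import Order.TTheory GRing.Theory Num.Theory.
Local Open Scope ring_scope.
Local Open Scope complex_scope.

(** Kushilevitz's Boolean function of six bits has degree 3, vanishes at 0, and
    changes value under every single flip at 0.  These properties are
    multiplicative under composition, so its k-fold iterate has degree at most
    3^k and all 6^k flips at 0 change its value; for the corresponding sign
    function f this gives (Delta f)(0) = 6^k = d^(log 6 / log 3). *)

(** * Kushilevitz's function on six bits *)

Definition pairs : seq (nat * nat) :=
  [:: (0, 1); (0, 2); (0, 3); (0, 4); (0, 5); (1, 2); (1, 3); (1, 4); (1, 5);
      (2, 3); (2, 4); (2, 5); (3, 4); (3, 5); (4, 5)]%N.

(* The blocks of a 2-(6,3,2) design: each pair of points lies in two blocks. *)
Definition blocks : seq (nat * nat * nat) :=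
  [:: (0, 1, 2); (0, 1, 3); (0, 2, 4); (0, 3, 5); (0, 4, 5);
      (1, 2, 5); (1, 3, 4); (1, 4, 5); (2, 3, 4); (2, 3, 5)]%N.

Definition linear_part (b : nat -> bool) : nat := (\sum_(i <- iota 0 6) b i)%N.

Definition quadratic_part (b : nat -> bool) : nat :=
  (\sum_(p <- pairs) b p.1 * b p.2)%N.

Definition cubic_part (b : nat -> bool) : nat :=
  (\sum_(p <- blocks) b p.1.1 * b p.1.2 * b p.2)%N.

(** Tests whether linear - quadratic + cubic equals 1; the quadratic part is moved to the right
    because subtraction on [nat] truncates. *)
Definition kushilevitz (b : nat -> bool) : bool :=
  linear_part b + cubic_part b == (quadratic_part b).+1.

(* The polynomial linear - quadratic + cubic takes only the values 0 and 1. *)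
Lemma kushilevitzE (b : nat -> bool) :
  (kushilevitz b + quadratic_part b = linear_part b + cubic_part b)%N.
Proof.
rewrite /kushilevitz /linear_part /quadratic_part /cubic_part unlock /=.
by case: (b 0); case: (b 1); case: (b 2); case: (b 3); case: (b 4); case: (b 5).
Qed.

Lemma eq_kushilevitz (b c : nat -> bool) :
  (forall i, (i < 6)%N -> b i = c i) -> kushilevitz b = kushilevitz c.
Proof.
move=> bc; rewrite /kushilevitz /linear_part /quadratic_part /cubic_part unlock.
by rewrite /= !bc.
Qed.

Lemma kushilevitz0 : kushilevitz (fun=> false) = false.
Proof.
by rewrite /kushilevitz /linear_part /quadratic_part /cubic_part unlock.
Qed.

Lemma kushilevitz_delta (q : nat) : (q < 6)%N -> kushilevitz (fun i => i == q).
Proof.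
rewrite /kushilevitz /linear_part /quadratic_part /cubic_part unlock.
by case: q => [|[|[|[|[|[|q]]]]]].
Qed.

(** * Iterates and their values at 0 and at unit vectors *)

Fixpoint iterk (k : nat) (x : nat -> bool) : bool :=
  if k is k'.+1 then
    kushilevitz (fun i => iterk k' (fun j => x (i * 6 ^ k' + j)%N))
  else x 0%N.

Lemma eq_iterk (k : nat) (x y : nat -> bool) :
  (forall j, (j < 6 ^ k)%N -> x j = y j) -> iterk k x = iterk k y.
Proof.
elim: k x y => [|k IHk] x y xy /=; first exact: xy.
apply: eq_kushilevitz => i i6; apply: IHk => j jk; apply: xy.
rewrite expnS; apply: (@leq_trans (i.+1 * 6 ^ k)); last first.
  by rewrite leq_mul2r i6 orbT.
by rewrite mulSn addnC ltn_add2r.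
Qed.

Lemma iterk0 (k : nat) : iterk k (fun=> false) = false.
Proof.
elim: k => //= k IHk; rewrite -[RHS]kushilevitz0.
by apply: eq_kushilevitz => i _.
Qed.

(** Only the block numbered by the leading base-6 digit of [m] contains a true bit. It evaluates to
    true by induction and the others to false by [iterk0], so the outer function again sees a unit
    vector. *)
Lemma iterk_delta (k m : nat) : (m < 6 ^ k)%N -> iterk k (fun j => j == m).
Proof.
elim: k m => [|k IHk] m; first by rewrite expn0 ltnS leqn0 => /eqP ->.
rewrite expnS /= => mk; have k0 : (0 < 6 ^ k)%N by rewrite expn_gt0.
rewrite -[is_true _]/(_ = true) -(kushilevitz_delta (m %/ 6 ^ k)); last first.
  by rewrite ltn_divLR.
apply: eq_kushilevitz => i _.
have eq_digits j : (j < 6 ^ k)%N ->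
    (i * 6 ^ k + j == m)%N = (i == m %/ 6 ^ k)%N && (j == m %% 6 ^ k)%N.
  move=> jk; apply/eqP/andP => [<-|[/eqP -> /eqP ->]]; last by rewrite -divn_eq.
  by rewrite divnMDl // divn_small // addn0 modnMDl modn_small.
rewrite (eq_iterk k _ _ eq_digits); case: eqP => _; last exact: iterk0.
by apply: IHk; rewrite ltn_mod.
Qed.

(** * Degree bounds through sums of juntas *)

Section JuntaSpan.
Variables (R : realType) (n : nat).
Implicit Types f g : cube n -> R[i].

(** A form of degree at most [d] suited to products: degrees add under multiplication without
    computing any Fourier coefficient. The pointwise equation in [JuntaSpanD] lets the predicate
    pass between pointwise equal functions. *)
Inductive junta_span (d : nat) : (cube n -> R[i]) -> Prop :=
| JuntaSpan (A : {set 'I_n}) g of (#|A| <= d)%N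
    & (forall j delta, j \notin A -> g (flip j delta) = g delta) :
    junta_span d g
| JuntaSpanD f g h of junta_span d f & junta_span d g
    & (forall delta, h delta = f delta + g delta) : junta_span d h.

Lemma junta_span_leq (d e : nat) f :
  (d <= e)%N -> junta_span d f -> junta_span e f.
Proof.
move=> de; elim=> [A g Ad gA|g1 g2 h _ s1 _ s2 hE]; last first.
  exact: JuntaSpanD s1 s2 hE.
by apply: JuntaSpan gA; apply: leq_trans de.
Qed.

Lemma junta_span_cst (d : nat) (c : R[i]) : junta_span d (fun=> c).
Proof. by apply: (@JuntaSpan _ set0); rewrite ?cards0. Qed.

Lemma junta_spanM (d e : nat) f g :
  junta_span d f -> junta_span e g ->
  junta_span (d + e) (fun delta => f delta * g delta).
Proof.
move=> sf sg; elim: sf => [A {}f Ad fA|f1 f2 h _ s1 _ s2 hE]; last first.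
  by apply: JuntaSpanD s1 s2 _ => delta; rewrite hE mulrDl.
elim: sg => [B {}g Be gB|g1 g2 h _ s1 _ s2 hE]; last first.
  by apply: JuntaSpanD s1 s2 _ => delta; rewrite hE mulrDr.
apply: (@JuntaSpan _ (A :|: B)).
  by rewrite (leq_trans (leq_card_setU A B)) // leq_add.
by move=> j delta; rewrite inE negb_or => /andP[jA jB]; rewrite fA // gB.
Qed.

Lemma junta_spanZ (d : nat) (c : R[i]) f :
  junta_span d f -> junta_span d (fun delta => c * f delta).
Proof. exact: (@junta_spanM 0 d (fun=> c)) (junta_span_cst 0 c). Qed.

Lemma junta_span_sum (I : Type) (d : nat) (r : seq I) (F : I -> cube n -> R[i]) :
  (forall i, junta_span d (F i)) ->
  junta_span d (fun delta => \sum_(i <- r) F i delta).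
Proof.
move=> sF; elim: r => [|i r IHr].
  apply: JuntaSpanD (junta_span_cst d 0) (junta_span_cst d 0) _ => delta.
  by rewrite big_nil addr0.
by apply: JuntaSpanD (sF i) IHr _ => delta; rewrite big_cons.
Qed.

Lemma flipK (j : 'I_n) : involutive (@flip n j).
Proof.
move=> delta; apply/ffunP => i; rewrite /flip !ffunE.
by case: eqP => // _; rewrite negbK.
Qed.

Lemma walsh_flip (S : {set 'I_n}) (j : 'I_n) (delta : cube n) :
  j \in S -> walsh R S (flip j delta) = - walsh R S delta.
Proof.
move=> jS; rewrite /walsh !(bigD1 j jS) /= -mulNr; congr (_ * _).
  by rewrite /Defs.coord /flip ffunE eqxx signrN.
by apply: eq_bigr => i /andP[_ /negPf ij]; rewrite /Defs.coord /flip ffunE ij.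
Qed.

(* A set S with more than d elements contains a coordinate j on which the junta
   does not depend; flipping j negates the sum defining the coefficient. *)
Lemma junta_span_Deg_le (d : nat) f : junta_span d f -> Deg_le d f.
Proof.
move=> sf S dS; elim: sf => [A g Ad gA|g1 g2 h _ s1 _ s2 hE].
  have /subsetPn[j jS jA] : ~~ (S \subset A).
    by apply: contraTN dS => /subset_leq_card SA; rewrite -leqNgt (leq_trans SA).
  rewrite /fourier; set s := \sum_delta _.
  suff /eqP : s = - s.
    by rewrite -addr_eq0 -mulr2n mulrn_eq0 /= => /eqP ->; rewrite mulr0.
  rewrite {1}/s (reindex_inj (inv_inj (flipK j))) /= -sumrN.
  by apply: eq_bigr => delta _; rewrite gA // walsh_flip // mulrN.
move: s1 s2; rewrite /fourier => s1 s2.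
under eq_bigr do rewrite hE mulrDl.
by rewrite big_split mulrDr /= s1 s2 addr0.
Qed.

(** Over [R[i]], [kushilevitzE] can be solved for the Boolean value, a polynomial whose monomials
    have at most three factors. *)
Lemma junta_span_kushilevitz (d : nat) (b : nat -> cube n -> bool) :
  (forall i, junta_span d (fun delta => (b i delta)%:R)) ->
  junta_span (3 * d) (fun delta => (kushilevitz (b^~ delta))%:R).
Proof.
move=> sb; pose B i delta : R[i] := (b i delta)%:R.
have s1 : junta_span (3 * d) (fun delta => \sum_(i <- iota 0 6) B i delta).
  by apply: junta_span_sum => i; apply: junta_span_leq (sb i); rewrite leq_pmull.
have s2 : junta_span (3 * d)
    (fun delta => -1 * \sum_(p <- pairs) B p.1 delta * B p.2 delta).
  apply/junta_spanZ/junta_span_sum => p.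
  apply: junta_span_leq (junta_spanM _ _ _ _ (sb p.1) (sb p.2)).
  by rewrite addnn -mul2n leq_mul2r orbT.
have s3 : junta_span (3 * d) (fun delta =>
    \sum_(p <- blocks) B p.1.1 delta * B p.1.2 delta * B p.2 delta).
  apply: junta_span_sum => p; rewrite !mulSn mul0n addn0 addnA.
  by apply: junta_spanM (sb _); apply: junta_spanM (sb _) (sb _).
apply: JuntaSpanD (JuntaSpanD _ _ _ _ s1 s3 (fun=> erefl)) s2 _ => delta.
have /(congr1 (fun m => m%:R : R[i])) := kushilevitzE (b^~ delta).
rewrite !natrD => /(canRL (addrK _)) ->; rewrite mulN1r !natr_sum.
congr (_ + _ - _); apply: eq_bigr => p _; by rewrite !natrM.
Qed.

Definition extend (delta : cube n) (m : nat) : bool :=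
  if insub m is Some i then delta i else false.

(** The offset [o] is there so that the induction hypothesis applies to each of the six blocks. *)
Lemma junta_span_iterk (k o : nat) :
  junta_span (3 ^ k)
    (fun delta => (iterk k (fun j => extend delta (o + j)))%:R).
Proof.
elim: k o => [|k IHk] o.
  (* This set is empty when [o] is at least [n]; the bit read is then constantly false. *)
  apply: (@JuntaSpan _ [set i | val i == o]) => /=.
    apply/card_le1_eqP => i j; rewrite !inE => /eqP <- /eqP ij.
    by apply: val_inj.
  move=> j delta; rewrite inE addn0 /extend => jo.
  case: insubP => // i _ io; rewrite /flip ffunE; case: eqP => // ij.
  by rewrite -ij io eqxx in jo.
rewrite expnS.
apply: (junta_span_kushilevitz _
  (fun i delta => iterk k (fun j => extend delta (o + (i * 6 ^ k + j))))) => i.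
(* Adding the zero function replaces an appeal to function extensionality. *)
apply: JuntaSpanD (IHk (o + i * 6 ^ k)%N) (junta_span_cst _ 0) _ => delta.
by rewrite addr0; congr (nat_of_bool _)%:R; apply: eq_iterk => j _; rewrite addnA.
Qed.

Lemma extend_cst0 : extend [ffun=> false] =1 (fun=> false).
Proof. by move=> m; rewrite /extend; case: insubP => // i; rewrite ffunE. Qed.

Lemma extend_flip_cst0 (j : 'I_n) (m : nat) :
  extend (flip j [ffun=> false]) m = (m == j).
Proof.
rewrite /extend; case: insubP => [i _ <-|].
  by rewrite /flip !ffunE -val_eqE; case: eqP.
by move=> mn; symmetry; apply: contraNF mn => /eqP ->.
Qed.

End JuntaSpan.

(** The case k = 1 is exp (ln b) = b; the exponents k and ln b / ln a then commute. *)
Lemma powR_ln_ratio (R : realType) (a b : R) (k : nat) :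
  1 < a -> 0 < b -> powR (a ^+ k) (ln b / ln a) = b ^+ k.
Proof.
move=> a1 b0; have a0 : 0 < a by apply: lt_trans a1.
have lna : ln a != 0 by rewrite gt_eqF // ln_gt0.
have ab : powR a (ln b / ln a) = b.
  by rewrite /powR gt_eqF // divfK // lnK.
by rewrite -powR_mulrn ?ltW // -powRrM mulrC powRrM ab powR_mulrn ?ltW.
Qed.

Theorem proposition1p7 (R : realType) (k n d : nat)
    (hn : n = (6 ^ k)%N) (hd : d = (3 ^ k)%N) :
  exists f : cube n -> R[i],
    [/\ forall delta : cube n, f delta = 1 \/ f delta = -1,
        Deg_le d f
      & Linfty_norm (laplacian f)
          >= powR (d%:R : R) (ln 6 / ln 3) * Linfty_norm f].
Proof.
pose F (delta : cube n) := iterk k (extend _ delta).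
pose f (delta : cube n) : R[i] := (-1) ^+ F delta.
have f_pm1 delta : f delta = 1 \/ f delta = -1.
  by rewrite /f; case: (F delta); [right | left].
exists f; split => //.
  rewrite hd; apply/junta_span_Deg_le.
  (* The sign of a bit b is the affine expression 1 - 2b, so [f] inherits the degree bound of the
     iterate. *)
  apply: JuntaSpanD (junta_span_cst _ _ _ 1)
    (junta_spanZ _ _ _ (-2) _ (junta_span_iterk _ _ k 0)) _ => delta.
  rewrite /f /F; case: iterk; rewrite ?mulr0 ?addr0 //.
  by rewrite mulr1 expr1 -[2]/(1 + 1) opprD addNKr.
have F0 : F [ffun=> false] = false.
  by rewrite -[RHS](iterk0 k); apply: eq_iterk => j _; exact: extend_cst0.
have F1 j : F (flip j [ffun=> false]).
  rewrite -[is_true _]/(_ = true) -(iterk_delta k j); last by rewrite -hn.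
  by apply: eq_iterk => m _; exact: extend_flip_cst0.
have lap0 : laplacian f [ffun=> false] = n%:R.
  rewrite /laplacian -[n in RHS]card_ord -sumr_const; apply: eq_bigr => j _.
  rewrite /Defs.partial /f F0 F1 expr0 expr1 opprK -[1 + 1]/2%:R.
  by rewrite divff // pnatr_eq0.
have normf : Linfty_norm f <= 1.
  apply: bigmax_le => // delta _.
  by case: (f_pm1 delta) => ->; rewrite ?normcN Normc.normc1.
(* The norm of the Laplacian is at least its modulus at the all-false vector, the point (1, ..., 1)
   of the cube. *)
apply: (@le_trans _ _ n%:R); last first.
  have <- : Normc.normc (laplacian f [ffun=> false]) = n%:R.
    by rewrite lap0 normcMn Normc.normc1.
  exact: le_bigmax.
have -> : n%:R = 6 ^+ k :> R by rewrite hn natrX.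
rewrite hd natrX powR_ln_ratio ?ltr1n ?ltr0n //.
by rewrite ler_piMr // exprn_ge0.
Qed.
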